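(* The sequent calculus $\mathcal{G}\mathrm{Ciore}$ admits cut-elimination: for all finite sets of formulas $\Gamma,\Delta$, if the sequent $\Gamma\Rightarrow\Delta$ is provable in $\mathcal{G}\mathrm{Ciore}$ (possibly using the cut rule), then $\Gamma\Rightarrow\Delta$ has a proof in $\mathcal{G}\mathrm{Ciore}$ that does not use the cut rule.
   Context: Formulas are built from a denumerable set of propositional variables with binary connectives $\wedge,\vee,\to$ and unary connectives $\neg,\circ$. A sequent is an expression $\Gamma\Rightarrow\Delta$ with $\Gamma,\Delta$ finite sets of formulas; ''$\Gamma,\alpha$'' means $\Gamma\cup\{\alpha\}$. The calculus $\mathcal{G}\mathrm{Ciore}$ has the following axioms and rules (for all formulas $\alpha,\beta$ and finite sets $\Gamma,\Delta$; ''from ... infer ...'' lists the premises, then the conclusion). Axioms: $\alpha\Rightarrow\alpha$. Structural rules: (w$\Rightarrow$) from $\Gamma\Rightarrow\Delta$ infer $\Gamma,\alpha\Rightarrow\Delta$; ($\Rightarrow$w) from $\Gamma\Rightarrow\Delta$ infer $\Gamma\Rightarrow\Delta,\alpha$; (cut) from $\Gamma\Rightarrow\Delta,\alpha$ and $\Gamma,\alpha\Rightarrow\Delta$ infer $\Gamma\Rightarrow\Delta$. Logical rules: ($\vee\Rightarrow$) from $\Gamma,\alpha\Rightarrow\Delta$ and $\Gamma,\beta\Rightarrow\Delta$ infer $\Gamma,\alpha\vee\beta\Rightarrow\Delta$. ($\Rightarrow\vee$) from $\Gamma\Rightarrow\Delta,\alpha,\beta$ infer $\Gamma\Rightarrow\Delta,\alpha\vee\beta$.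 ($\neg\vee\Rightarrow$) from $\Gamma,\alpha,\neg\alpha,\beta,\neg\beta\Rightarrow\Delta$ and $\Gamma,\neg\alpha,\neg\beta\Rightarrow\Delta,\alpha,\beta$ infer $\Gamma,\neg(\alpha\vee\beta)\Rightarrow\Delta$. ($\Rightarrow\neg\vee$) from $\Gamma\Rightarrow\Delta,\alpha$; $\Gamma\Rightarrow\Delta,\neg\alpha$; $\Gamma\Rightarrow\Delta,\beta$; $\Gamma\Rightarrow\Delta,\neg\beta$ infer $\Gamma\Rightarrow\Delta,\neg(\alpha\vee\beta)$. ($\wedge\Rightarrow$) from $\Gamma,\alpha,\beta\Rightarrow\Delta$ infer $\Gamma,\alpha\wedge\beta\Rightarrow\Delta$. ($\Rightarrow\wedge$) from $\Gamma\Rightarrow\Delta,\alpha$ and $\Gamma\Rightarrow\Delta,\beta$ infer $\Gamma\Rightarrow\Delta,\alpha\wedge\beta$. ($\neg\wedge\Rightarrow$) from $\Gamma\Rightarrow\Delta,\alpha,\beta$; $\Gamma,\neg\alpha\Rightarrow\Delta,\alpha$; $\Gamma,\neg\beta\Rightarrow\Delta,\beta$; $\Gamma,\neg\alpha,\neg\beta\Rightarrow\Delta$ infer $\Gamma,\neg(\alpha\wedge\beta)\Rightarrow\Delta$. ($\Rightarrow\neg\wedge$) from $\Gamma\Rightarrow\Delta,\alpha$; $\Gamma\Rightarrow\Delta,\neg\alpha$; $\Gamma\Rightarrow\Delta,\beta$; $\Gamma\Rightarrow\Delta,\neg\beta$ infer $\Gamma\Rightarrow\Delta,\neg(\alpha\wedge\beta)$.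 ($\to\Rightarrow$) from $\Gamma\Rightarrow\Delta,\alpha$ and $\Gamma,\beta\Rightarrow\Delta$ infer $\Gamma,\alpha\to\beta\Rightarrow\Delta$. ($\Rightarrow\to$) from $\Gamma,\alpha\Rightarrow\Delta,\beta$ infer $\Gamma\Rightarrow\Delta,\alpha\to\beta$. ($\neg\to\Rightarrow$) from $\Gamma,\alpha,\neg\beta\Rightarrow\Delta,\beta$ and $\Gamma,\alpha,\neg\alpha,\neg\beta\Rightarrow\Delta$ infer $\Gamma,\neg(\alpha\to\beta)\Rightarrow\Delta$. ($\Rightarrow\neg\to$) from $\Gamma\Rightarrow\Delta,\alpha$; $\Gamma\Rightarrow\Delta,\neg\alpha$; $\Gamma\Rightarrow\Delta,\beta$; $\Gamma\Rightarrow\Delta,\neg\beta$ infer $\Gamma\Rightarrow\Delta,\neg(\alpha\to\beta)$. ($\Rightarrow\neg$) from $\Gamma,\alpha\Rightarrow\Delta$ infer $\Gamma\Rightarrow\Delta,\neg\alpha$. ($\neg\neg\Rightarrow$) from $\Gamma,\alpha\Rightarrow\Delta$ infer $\Gamma,\neg\neg\alpha\Rightarrow\Delta$. ($\Rightarrow\neg\neg$) from $\Gamma\Rightarrow\Delta,\alpha$ infer $\Gamma\Rightarrow\Delta,\neg\neg\alpha$. ($\circ\Rightarrow$) from $\Gamma\Rightarrow\Delta,\alpha$ and $\Gamma\Rightarrow\Delta,\neg\alpha$ infer $\Gamma,\circ\alpha\Rightarrow\Delta$. ($\Rightarrow\circ$) from $\Gamma,\alpha,\neg\alpha\Rightarrow\Delta$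 infer $\Gamma\Rightarrow\Delta,\circ\alpha$. ($\neg\circ\Rightarrow$) from $\Gamma,\alpha,\neg\alpha\Rightarrow\Delta$ infer $\Gamma,\neg\circ\alpha\Rightarrow\Delta$. *)

(* Defs.v *)
From HB Require Import structures.
From mathcomp Require Import all_boot finmap.

Set Implicit Arguments.
Unset Strict Implicit.
Unset Printing Implicit Defensive.

Local Open Scope fset_scope.

Inductive formula : Type :=
  | Var of nat
  | And of formula & formula
  | Or of formula & formula
  | Imp of formula & formula
  | Neg of formula
  | Circ of formula.

(* [{fset formula}] needs a choiceType structure on [formula]; it is obtained
   by encoding formulas as generic trees. *)
Fixpoint formula_encode (a : formula) : GenTree.tree nat :=
  match a with
  | Var n => GenTree.Leaf n
  | And b c => GenTree.Node 0 [:: formula_encode b; formula_encode c]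
  | Or b c => GenTree.Node 1 [:: formula_encode b; formula_encode c]
  | Imp b c => GenTree.Node 2 [:: formula_encode b; formula_encode c]
  | Neg b => GenTree.Node 3 [:: formula_encode b]
  | Circ b => GenTree.Node 4 [:: formula_encode b]
  end.

Fixpoint formula_decode (t : GenTree.tree nat) : formula :=
  match t with
  | GenTree.Leaf n => Var n
  | GenTree.Node 0 [:: u; v] => And (formula_decode u) (formula_decode v)
  | GenTree.Node 1 [:: u; v] => Or (formula_decode u) (formula_decode v)
  | GenTree.Node 2 [:: u; v] => Imp (formula_decode u) (formula_decode v)
  | GenTree.Node 3 [:: u] => Neg (formula_decode u)
  | GenTree.Node 4 [:: u] => Circ (formula_decode u)
  | GenTree.Node _ _ => Var 0
  end.

Lemma formula_encodeK : cancel formula_encode formula_decode.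
Proof. by elim=> //= [b -> c ->|b -> c ->|b -> c ->|b ->|b ->]. Qed.

HB.instance Definition _ := Countable.copy formula (can_type formula_encodeK).

(* [proof G D] is the type of derivation trees with end-sequent G => D.
   Since the sides are sets, "G, a" is [a |` G] with a possibly already in G,
   and contraction and exchange are implicit. *)
Inductive proof : {fset formula} -> {fset formula} -> Type :=
  | Ax a : proof [fset a] [fset a]

  | WeakL G D a : proof G D -> proof (a |` G) D
  | WeakR G D a : proof G D -> proof G (a |` D)
  | Cut G D a : proof G (a |` D) -> proof (a |` G) D -> proof G D

  | OrL G D a b :
      proof (a |` G) D -> proof (b |` G) D -> proof (Or a b |` G) D
  | OrR G D a b :
      proof G (a |` (b |` D)) -> proof G (Or a b |` D)
  | NegOrL G D a b :
      proof (a |` (Neg a |` (b |` (Neg b |` G)))) D ->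
      proof (Neg a |` (Neg b |` G)) (a |` (b |` D)) ->
      proof (Neg (Or a b) |` G) D
  | NegOrR G D a b :
      proof G (a |` D) -> proof G (Neg a |` D) ->
      proof G (b |` D) -> proof G (Neg b |` D) ->
      proof G (Neg (Or a b) |` D)

  | AndL G D a b :
      proof (a |` (b |` G)) D -> proof (And a b |` G) D
  | AndR G D a b :
      proof G (a |` D) -> proof G (b |` D) -> proof G (And a b |` D)
  | NegAndL G D a b :
      proof G (a |` (b |` D)) ->
      proof (Neg a |` G) (a |` D) ->
      proof (Neg b |` G) (b |` D) ->
      proof (Neg a |` (Neg b |` G)) D ->
      proof (Neg (And a b) |` G) D
  | NegAndR G D a b :
      proof G (a |` D) -> proof G (Neg a |` D) ->
      proof G (b |` D) -> proof G (Neg b |` D) ->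
      proof G (Neg (And a b) |` D)

  | ImpL G D a b :
      proof G (a |` D) -> proof (b |` G) D -> proof (Imp a b |` G) D
  | ImpR G D a b :
      proof (a |` G) (b |` D) -> proof G (Imp a b |` D)
  | NegImpL G D a b :
      proof (a |` (Neg b |` G)) (b |` D) ->
      proof (a |` (Neg a |` (Neg b |` G))) D ->
      proof (Neg (Imp a b) |` G) D
  | NegImpR G D a b :
      proof G (a |` D) -> proof G (Neg a |` D) ->
      proof G (b |` D) -> proof G (Neg b |` D) ->
      proof G (Neg (Imp a b) |` D)
  (* The calculus has no left rule for a single negation *)
  | NegR G D a : proof (a |` G) D -> proof G (Neg a |` D)
  | NegNegL G D a : proof (a |` G) D -> proof (Neg (Neg a) |` G) D
  | NegNegR G D a : proof G (a |` D) -> proof G (Neg (Neg a) |` D)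
  (* The calculus has no right rule for a negated Circ *)
  | CircL G D a :
      proof G (a |` D) -> proof G (Neg a |` D) -> proof (Circ a |` G) D
  | CircR G D a :
      proof (a |` (Neg a |` G)) D -> proof G (Circ a |` D)
  | NegCircL G D a :
      proof (a |` (Neg a |` G)) D -> proof (Neg (Circ a) |` G) D.

Fixpoint cut_free G D (p : proof G D) : bool :=
  match p with
  | Ax _ => true
  | WeakL _ _ _ p1 => cut_free p1
  | WeakR _ _ _ p1 => cut_free p1
  | Cut _ _ _ _ _ => false
  | OrL _ _ _ _ p1 p2 => cut_free p1 && cut_free p2
  | OrR _ _ _ _ p1 => cut_free p1
  | NegOrL _ _ _ _ p1 p2 => cut_free p1 && cut_free p2
  | NegOrR _ _ _ _ p1 p2 p3 p4 =>
      [&& cut_free p1, cut_free p2, cut_free p3 & cut_free p4]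
  | AndL _ _ _ _ p1 => cut_free p1
  | AndR _ _ _ _ p1 p2 => cut_free p1 && cut_free p2
  | NegAndL _ _ _ _ p1 p2 p3 p4 =>
      [&& cut_free p1, cut_free p2, cut_free p3 & cut_free p4]
  | NegAndR _ _ _ _ p1 p2 p3 p4 =>
      [&& cut_free p1, cut_free p2, cut_free p3 & cut_free p4]
  | ImpL _ _ _ _ p1 p2 => cut_free p1 && cut_free p2
  | ImpR _ _ _ _ p1 => cut_free p1
  | NegImpL _ _ _ _ p1 p2 => cut_free p1 && cut_free p2
  | NegImpR _ _ _ _ p1 p2 p3 p4 =>
      [&& cut_free p1, cut_free p2, cut_free p3 & cut_free p4]
  | NegR _ _ _ p1 => cut_free p1
  | NegNegL _ _ _ p1 => cut_free p1
  | NegNegR _ _ _ p1 => cut_free p1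
  | CircL _ _ _ p1 p2 => cut_free p1 && cut_free p2
  | CircR _ _ _ p1 => cut_free p1
  | NegCircL _ _ _ p1 => cut_free p1
  end.

Definition provable (G D : {fset formula}) : Prop := inhabited (proof G D).

(* Main.v *)
(* Formulas are interpreted in three values: "true", "false", and a designated
   third value at which a formula and its negation both hold; every rule,
   including cut, is sound. Conversely, inside a finite universe containing a
   subformula-closed set and the negations of its members, a sequent that is
   maximal without a cut-free proof is closed under all logical rules read
   upwards. The right rules for negated connectives are not invertible, but
   [NegR] puts the unnegated formula on the left of such a sequent, and this
   recovers the missing information; the sequent then defines a countermodel.
   Hence provable sequents, being valid, have cut-free proofs. *)
Require Import Defs.
From mathcomp Require Import all_boot finmap zify.
From Stdlib Require Import Classical_Prop.

Set Implicit Arguments.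
Unset Strict Implicit.
Unset Printing Implicit Defensive.

Local Open Scope fset_scope.

(** * Three-valued semantics and soundness *)

(* [None] is the third value: both the formula and its negation hold. *)
Definition tv := option bool.

Definition designated (x : tv) : bool := x != Some false.

Definition tv_neg : tv -> tv := omap negb.

(** A compound takes the third value only when both operands do, matching the four premises of
    [NegAndR], [NegOrR] and [NegImpR]. *)
Definition tv_lift (f : bool -> bool -> bool) (x y : tv) : tv :=
  if (x, y) is (None, None) then None
  else Some (f (designated x) (designated y)).

Fixpoint eval (v : nat -> tv) (a : formula) : tv :=
  match a with
  | Var n => v n
  | And b c => tv_lift andb (eval v b) (eval v c)
  | Or b c => tv_lift orb (eval v b) (eval v c)
  | Imp b c => tv_lift implb (eval v b) (eval v c)
  | Neg b => tv_neg (eval v b)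
  | Circ b => Some (eval v b != None)
  end.

Definition holds v a : bool := designated (eval v a).

Lemma all_fset1U (K : choiceType) (p : pred K) a (A : {fset K}) :
  all p (a |` A) = p a && all p A.
Proof.
apply/allP/andP => [h|[pa /allP h] x].
  split; first by apply/h/fset1U1.
  by apply/allP => x xA; apply/h/fset1Ur.
by rewrite in_fset1U => /orP[/eqP ->|/h].
Qed.

Lemma has_fset1U (K : choiceType) (p : pred K) a (A : {fset K}) :
  has p (a |` A) = p a || has p A.
Proof. by apply: negb_inj; rewrite negb_or -!all_predC all_fset1U. Qed.

Lemma soundness v G D : proof G D -> all (holds v) G ==> has (holds v) D.
Proof.
elim=> {G D}.
  by move=> a; apply/implyP => /allP ha; apply/hasP; exists a; rewrite ?ha ?inE.
all: intros; repeat match goal with h : is_true _ |- _ => revert h end.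
(* A rule sees its contexts only through the truth values [g] and [d], so a finite table check
   remains. *)
all: rewrite ?all_fset1U ?has_fset1U; move: (all _ G) (has _ D) => g d.
all: rewrite /holds /=; case: g; case: d; rewrite ?andbF ?andbT ?orbT ?orbF //=.
all: repeat match goal with
  | |- context [eval ?w ?b] => case: (eval w b) => [[]|] //=
  end.
Qed.

(** * Cut-free provability and weakening *)

Definition cf_provable G D : Prop := exists p : proof G D, cut_free p.

Lemma cf_weakening G D G' D' :
  cf_provable G D -> cf_provable (G' `|` G) (D' `|` D).
Proof.
move=> pGD; have {pGD} : cf_provable (G' `|` G) D.
  elim/finSet_rect: G' => A IH.
  have [->|[a aA]] := fset_0Vmem A; first by rewrite fset0U.
  have [|p cp] := IH (A `\ a); first by rewrite fproperD1.
  by rewrite -(fsetD1K aA) -fsetUA; exists (WeakL a p).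
move: (G' `|` G) => GG pGD.
elim/finSet_rect: D' => A IH.
have [->|[a aA]] := fset_0Vmem A; first by rewrite fset0U.
have [|p cp] := IH (A `\ a); first by rewrite fproperD1.
by rewrite -(fsetD1K aA) -fsetUA; exists (WeakR a p).
Qed.

(** A fold, so that on a literal list it unfolds to the nested insertions found in the premises of
    the rules. *)
Definition adjoin (s : seq formula) (G : {fset formula}) : {fset formula} :=
  foldr (fun a A => a |` A) G s.

Lemma in_adjoin s G a : (a \in adjoin s G) = (a \in s) || (a \in G).
Proof. by elim: s => //= b s IH; rewrite !inE IH orbA. Qed.

Lemma fsubset_adjoin s G : G `<=` adjoin s G.
Proof. by apply/fsubsetP => a aG; rewrite in_adjoin aG orbT. Qed.

Lemma adjoin_fsubset s G (U : {fset formula}) :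
  all [in U] s -> G `<=` U -> adjoin s G `<=` U.
Proof.
move=> /allP sU /fsubsetP GU; apply/fsubsetP => a.
by rewrite in_adjoin => /orP[/sU|/GU].
Qed.

Lemma fproper_adjoin s G : ~~ all [in G] s -> G `<` adjoin s G.
Proof.
case/allPn => a aS aG; rewrite fproperE fsubset_adjoin /=.
by apply/fsubsetPn; exists a; rewrite ?in_adjoin ?aS.
Qed.

(** * Finite subformula-closed universes *)

Definition immediate_subformulas (a : formula) : seq formula :=
  match a with
  | Var _ => [::]
  | And b c | Or b c | Imp b c => [:: b; c]
  | Neg b | Circ b => [:: b]
  end.

Definition subformula_closed (S : {fset formula}) : Prop :=
  forall a, a \in S -> {subset immediate_subformulas a <= S}.

Fixpoint subformulas (a : formula) : {fset formula} :=
  a |` match a with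
       | Var _ => fset0
       | And b c | Or b c | Imp b c => subformulas b `|` subformulas c
       | Neg b | Circ b => subformulas b
       end.

Lemma subformulas_refl a : a \in subformulas a.
Proof. by case: a => *; rewrite /= fset1U1. Qed.

Lemma subformulas_closed a : subformula_closed (subformulas a).
Proof.
elim: a => /= [n|b IHb c IHc|b IHb c IHc|b IHb c IHc|b IHb|b IHb] x.
all: rewrite !inE => /orP[/eqP -> y|].
all: rewrite /= ?inE //.
all: try by move=> /orP[] /eqP ->; rewrite subformulas_refl ?orbT.
all: try by move=> /eqP ->; rewrite subformulas_refl ?orbT.
all: try by move=> /IHb h y /h yx; rewrite !inE yx ?orbT.
all: by move=> /orP[/IHb h|/IHc h] y /h yx; rewrite !inE yx ?orbT.
Qed.

Lemma subformula_closureP (A : {fset formula}) :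
  exists2 S, A `<=` S & subformula_closed S.
Proof.
elim/finSet_rect: A => A IH.
have [->|[a aA]] := fset_0Vmem A; first by exists fset0; rewrite ?fsub0set.
have [|S sS cS] := IH (A `\ a); first by rewrite fproperD1.
exists (subformulas a `|` S).
  by rewrite -(fsetD1K aA) fsetUSS // fsub1set subformulas_refl.
move=> x; rewrite inE => /orP[/subformulas_closed h|/cS h] y /h yx.
all: by rewrite inE yx ?orbT.
Qed.

(** For subformula-closed [S], a logical rule read upwards from a member of this set introduces only
    members of it. *)
Definition signed (S : {fset formula}) : {fset formula} :=
  S `|` [fset Neg a | a in S].

(** * Maximal unprovable sequents and their saturation *)

(** Both sides may grow at once because a single premise, as in [ImpR], can enlarge both. *)
Definition maximal_unprovable (U G D : {fset formula}) : Prop :=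
  ~ cf_provable G D /\
  forall s t, all [in U] s -> all [in U] t ->
    ~~ (all [in G] s && all [in D] t) ->
    cf_provable (adjoin s G) (adjoin t D).

(* No left rule applies to [Neg (Var n)], so its presence on the left alone does
   not determine [Var n]; the value "false" is chosen in that case. *)
Definition valuation_of (G : {fset formula}) (n : nat) : tv :=
  if Var n \in G then (if Neg (Var n) \in G then None else Some true)
  else Some false.

Lemma signed_mem S a : a \in S -> a \in signed S.
Proof. by rewrite inE => ->. Qed.

Lemma signed_neg S a : a \in S -> Neg a \in signed S.
Proof. by move=> aS; rewrite inE in_imfset ?orbT. Qed.

(* If saturation fails for a rule, each of its premises properly extends the
   sequent, hence is provable by maximality, and the rule applies. *)
Ltac saturate max_GD :=
  let mem := fresh "mem" in let nGD := fresh "nGD" in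
  move=> mem; apply: contraT; case: (max_GD) => nGD _ ?;
  (* Sides are sets, so inserting the principal formula again changes nothing: the sequent is itself
     the conclusion of the rule. *)
  case: nGD; rewrite -(mem_fset1U mem).

Tactic Notation "premise" constr(max_GD) uconstr(s) uconstr(t) :=
  case: (proj2 max_GD s t);
  [ by rewrite /= ?signed_neg ?signed_mem
  | by rewrite /= ?signed_neg ?signed_mem
  | match goal with unsat : is_true (~~ _) |- _ => move: unsat end;
    by rewrite /= ?andbT; repeat case: (_ \in _)
  | ].

Section Saturation.

Variables (S G D : {fset formula}).
Hypothesis max_GD : maximal_unprovable (signed S) G D.

(** Here and below, each disjunct of the condition says that one premise of the rule is already
    contained in the sequent. *)
Lemma saturated_AndL a b : a \in S -> b \in S -> And a b \in G ->
  (a \in G) && (b \in G).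
Proof.
move=> aS bS; saturate max_GD.
premise max_GD [:: a; b] [::] => p1 c1.
by exists (AndL p1); rewrite /= c1.
Qed.

Lemma saturated_AndR a b : a \in S -> b \in S -> And a b \in D ->
  (a \in D) || (b \in D).
Proof.
move=> aS bS; saturate max_GD.
premise max_GD [::] [:: a] => p1 c1.
premise max_GD [::] [:: b] => p2 c2.
by exists (AndR p1 p2); rewrite /= c1 c2.
Qed.

Lemma saturated_NegAndL a b : a \in S -> b \in S -> Neg (And a b) \in G ->
  [|| (a \in D) && (b \in D), (Neg a \in G) && (a \in D),
      (Neg b \in G) && (b \in D) | (Neg a \in G) && (Neg b \in G)].
Proof.
move=> aS bS; saturate max_GD.
premise max_GD [::] [:: a; b] => p1 c1.
premise max_GD [:: Neg a] [:: a] => p2 c2.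
premise max_GD [:: Neg b] [:: b] => p3 c3.
premise max_GD [:: Neg a; Neg b] [::] => p4 c4.
by exists (NegAndL p1 p2 p3 p4); rewrite /= c1 c2 c3 c4.
Qed.

Lemma saturated_NegAndR a b : a \in S -> b \in S -> Neg (And a b) \in D ->
  [|| a \in D, Neg a \in D, b \in D | Neg b \in D].
Proof.
move=> aS bS; saturate max_GD.
premise max_GD [::] [:: a] => p1 c1.
premise max_GD [::] [:: Neg a] => p2 c2.
premise max_GD [::] [:: b] => p3 c3.
premise max_GD [::] [:: Neg b] => p4 c4.
by exists (NegAndR p1 p2 p3 p4); rewrite /= c1 c2 c3 c4.
Qed.

Lemma saturated_OrL a b : a \in S -> b \in S -> Or a b \in G ->
  (a \in G) || (b \in G).
Proof.
move=> aS bS; saturate max_GD.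
premise max_GD [:: a] [::] => p1 c1.
premise max_GD [:: b] [::] => p2 c2.
by exists (OrL p1 p2); rewrite /= c1 c2.
Qed.

Lemma saturated_OrR a b : a \in S -> b \in S -> Or a b \in D ->
  (a \in D) && (b \in D).
Proof.
move=> aS bS; saturate max_GD.
premise max_GD [::] [:: a; b] => p1 c1.
by exists (OrR p1); rewrite /= c1.
Qed.

Lemma saturated_NegOrL a b : a \in S -> b \in S -> Neg (Or a b) \in G ->
  [&& a \in G, Neg a \in G, b \in G & Neg b \in G] ||
  [&& Neg a \in G, Neg b \in G, a \in D & b \in D].
Proof.
move=> aS bS; saturate max_GD.
premise max_GD [:: a; Neg a; b; Neg b] [::] => p1 c1.
premise max_GD [:: Neg a; Neg b] [:: a; b] => p2 c2.
by exists (NegOrL p1 p2); rewrite /= c1 c2.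
Qed.

Lemma saturated_NegOrR a b : a \in S -> b \in S -> Neg (Or a b) \in D ->
  [|| a \in D, Neg a \in D, b \in D | Neg b \in D].
Proof.
move=> aS bS; saturate max_GD.
premise max_GD [::] [:: a] => p1 c1.
premise max_GD [::] [:: Neg a] => p2 c2.
premise max_GD [::] [:: b] => p3 c3.
premise max_GD [::] [:: Neg b] => p4 c4.
by exists (NegOrR p1 p2 p3 p4); rewrite /= c1 c2 c3 c4.
Qed.

Lemma saturated_ImpL a b : a \in S -> b \in S -> Imp a b \in G ->
  (a \in D) || (b \in G).
Proof.
move=> aS bS; saturate max_GD.
premise max_GD [::] [:: a] => p1 c1.
premise max_GD [:: b] [::] => p2 c2.
by exists (ImpL p1 p2); rewrite /= c1 c2.
Qed.

Lemma saturated_ImpR a b : a \in S -> b \in S -> Imp a b \in D ->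
  (a \in G) && (b \in D).
Proof.
move=> aS bS; saturate max_GD.
premise max_GD [:: a] [:: b] => p1 c1.
by exists (ImpR p1); rewrite /= c1.
Qed.

Lemma saturated_NegImpL a b : a \in S -> b \in S -> Neg (Imp a b) \in G ->
  [&& a \in G, Neg b \in G & b \in D] ||
  [&& a \in G, Neg a \in G & Neg b \in G].
Proof.
move=> aS bS; saturate max_GD.
premise max_GD [:: a; Neg b] [:: b] => p1 c1.
premise max_GD [:: a; Neg a; Neg b] [::] => p2 c2.
by exists (NegImpL p1 p2); rewrite /= c1 c2.
Qed.

Lemma saturated_NegImpR a b : a \in S -> b \in S -> Neg (Imp a b) \in D ->
  [|| a \in D, Neg a \in D, b \in D | Neg b \in D].
Proof.
move=> aS bS; saturate max_GD.
premise max_GD [::] [:: a] => p1 c1.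
premise max_GD [::] [:: Neg a] => p2 c2.
premise max_GD [::] [:: b] => p3 c3.
premise max_GD [::] [:: Neg b] => p4 c4.
by exists (NegImpR p1 p2 p3 p4); rewrite /= c1 c2 c3 c4.
Qed.

Lemma saturated_NegR a : a \in S -> Neg a \in D -> a \in G.
Proof.
move=> aS; saturate max_GD.
premise max_GD [:: a] [::] => p1 c1.
by exists (NegR p1); rewrite /= c1.
Qed.

Lemma saturated_NegNegL a : a \in S -> Neg (Neg a) \in G -> a \in G.
Proof.
move=> aS; saturate max_GD.
premise max_GD [:: a] [::] => p1 c1.
by exists (NegNegL p1); rewrite /= c1.
Qed.

Lemma saturated_NegNegR a : a \in S -> Neg (Neg a) \in D -> a \in D.
Proof.
move=> aS; saturate max_GD.
premise max_GD [::] [:: a] => p1 c1.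
by exists (NegNegR p1); rewrite /= c1.
Qed.

Lemma saturated_CircL a : a \in S -> Circ a \in G ->
  (a \in D) || (Neg a \in D).
Proof.
move=> aS; saturate max_GD.
premise max_GD [::] [:: a] => p1 c1.
premise max_GD [::] [:: Neg a] => p2 c2.
by exists (CircL p1 p2); rewrite /= c1 c2.
Qed.

Lemma saturated_CircR a : a \in S -> Circ a \in D ->
  (a \in G) && (Neg a \in G).
Proof.
move=> aS; saturate max_GD.
premise max_GD [:: a; Neg a] [::] => p1 c1.
by exists (CircR p1); rewrite /= c1.
Qed.

Lemma saturated_NegCircL a : a \in S -> Neg (Circ a) \in G ->
  (a \in G) && (Neg a \in G).
Proof.
move=> aS; saturate max_GD.
premise max_GD [:: a; Neg a] [::] => p1 c1.
by exists (NegCircL p1); rewrite /= c1.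
Qed.

(** Otherwise the sequent would be a weakening of an axiom. *)
Lemma unprovable_disjoint a : a \in G -> a \notin D.
Proof.
move=> aG; apply/negP => aD; case: max_GD => nGD _; apply: nGD.
rewrite -(mem_fset1U aG) -(mem_fset1U aD) fsetUC [a |` D]fsetUC.
by apply: cf_weakening; exists (Ax a).
Qed.

(** * The truth lemma *)

(** Treating [a] together with [Neg a] strengthens the induction: rules for negated compounds
    mention negated operands, which are not subformulas. *)
Definition truthful v a : bool :=
  [&& (a \in G) ==> holds v a, (Neg a \in G) ==> holds v (Neg a),
      (a \in D) ==> ~~ holds v a & (Neg a \in D) ==> ~~ holds v (Neg a)].

Hypothesis closed_S : subformula_closed S.

(** Once the saturation conditions stand in the goal, memberships and values can be generalized to
    arbitrary ones and enumerated. *)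
Ltac by_cases_on_values v :=
  rewrite /truthful /holds /=;
  repeat match goal with
  | |- context [in_mem ?x ?A] => move: (in_mem x A) => ?
  | |- context [eval v ?x] => move: (eval v x) => ?
  end;
  repeat match goal with x : tv |- _ => case: x => [[]|] /= end;
  repeat match goal with
    b : bool |- _ => case: b; rewrite ?andbF ?orbT //=
  end.

Lemma truth_lemma a : a \in S -> truthful (valuation_of G) a.
Proof.
set v := valuation_of G.
elim: a => [n|b IHb c IHc|b IHb c IHc|b IHb c IHc|b IHb|b IHb] aS.
(* If [Neg (Var n)] is on the right, [Var n] is on the left and, by disjointness, [Neg (Var n)] is
   not, so the value is [Some true]. *)
- move: (saturated_NegR aS) (@unprovable_disjoint (Var n)).
  move: (@unprovable_disjoint (Neg (Var n))).
  rewrite /truthful /holds /= /v /valuation_of.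
  by case: (Var n \in G); case: (Neg _ \in G); case: (Var n \in D);
    case: (Neg _ \in D) => //=; intuition.
- have [bS cS] : b \in S /\ c \in S.
    by split; apply: (closed_S aS); rewrite !inE eqxx ?orbT.
  (* With [Neg (And b c)] on the right, [And b c] is on the left and holds; [saturated_NegAndR]
     rules out that both operands are third-valued, so the negation fails. The next two connectives
     go alike. *)
  move: (introT implyP (saturated_NegR aS)).
  move: (introT implyP (saturated_AndL bS cS)).
  move: (introT implyP (saturated_AndR bS cS)).
  move: (introT implyP (saturated_NegAndL bS cS)).
  move: (introT implyP (saturated_NegAndR bS cS)).
  move: (IHb bS) (IHc cS).
  by_cases_on_values v.
- have [bS cS] : b \in S /\ c \in S.
    by split; apply: (closed_S aS); rewrite !inE eqxx ?orbT.
  move: (introT implyP (saturated_NegR aS)).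
  move: (introT implyP (saturated_OrL bS cS)).
  move: (introT implyP (saturated_OrR bS cS)).
  move: (introT implyP (saturated_NegOrL bS cS)).
  move: (introT implyP (saturated_NegOrR bS cS)).
  move: (IHb bS) (IHc cS).
  by_cases_on_values v.
- have [bS cS] : b \in S /\ c \in S.
    by split; apply: (closed_S aS); rewrite !inE eqxx ?orbT.
  move: (introT implyP (saturated_NegR aS)).
  move: (introT implyP (saturated_ImpL bS cS)).
  move: (introT implyP (saturated_ImpR bS cS)).
  move: (introT implyP (saturated_NegImpL bS cS)).
  move: (introT implyP (saturated_NegImpR bS cS)).
  move: (IHb bS) (IHc cS).
  by_cases_on_values v.
- have bS : b \in S by apply: (closed_S aS); rewrite !inE.
  move: (introT implyP (saturated_NegNegL bS)).
  move: (introT implyP (saturated_NegNegR bS)) (IHb bS).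
  by_cases_on_values v.
- have bS : b \in S by apply: (closed_S aS); rewrite !inE.
  (* [Neg (Circ b)] on the right puts [Circ b] on the left; the value of [Circ b] is never third, so
     its negation fails. *)
  move: (introT implyP (saturated_NegR aS)).
  move: (introT implyP (saturated_CircL bS)).
  move: (introT implyP (saturated_CircR bS)).
  move: (introT implyP (saturated_NegCircL bS)) (IHb bS).
  by_cases_on_values v.
Qed.

Lemma signed_truth a : a \in signed S ->
  ((a \in G) ==> holds (valuation_of G) a) &&
  ((a \in D) ==> ~~ holds (valuation_of G) a).
Proof.
rewrite inE => /orP[/truth_lemma/and4P[-> _ -> //]|].
by case/imfsetP => b /= /truth_lemma/and4P[_ ? _ ?] ->; apply/andP.
Qed.

End Saturation.

(** * Completeness and cut elimination *)

(** Induction on the number of universe formulas missing from the two sides: the hypothesis proves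
    all proper extensions, so an unprovable valid sequent would be maximal and refuted by its own
    valuation. *)
Lemma completeness (G D : {fset formula}) :
  (forall v, all (holds v) G ==> has (holds v) D) -> cf_provable G D.
Proof.
have [S sGD closed_S] := subformula_closureP (G `|` D).
have /andP[] : (G `<=` signed S) && (D `<=` signed S).
  by rewrite -fsubUset (fsubset_trans sGD) ?fsubsetUl.
have [n] := ubnP ((#|` signed S| - #|` G|) + (#|` signed S| - #|` D|)).
elim: n G D {sGD} => // n IH G D lt_n sG sD valid_GD.
apply: NNPP => nGD.
have max_GD : maximal_unprovable (signed S) G D.
  split=> // s t sS tS new.
  have sG' := adjoin_fsubset sS sG; have sD' := adjoin_fsubset tS sD.
  apply: IH => // [|v].
    have := fsubset_leq_card sG'; have := fsubset_leq_card sD'.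
    have := fsubset_leq_card (fsubset_adjoin s G).
    have := fsubset_leq_card (fsubset_adjoin t D).
    move: new; rewrite negb_and => /orP[] /fproper_adjoin/fproper_ltn_card; lia.
  (* Validity survives adding formulas to either side. *)
  apply/implyP => /allP hG'.
  have hG : all (holds v) G.
    by apply/allP => a aG; apply: hG'; rewrite in_adjoin aG orbT.
  have /hasP[a aD ha] := implyP (valid_GD v) hG.
  by apply/hasP; exists a; rewrite ?in_adjoin ?aD ?orbT.
have truth := signed_truth max_GD closed_S.
have /implyP := valid_GD (valuation_of G); case/(_ _)/hasP.
  by apply/allP => a aG; have /andP[] := truth a (fsubsetP sG _ aG); rewrite aG.
move=> a aD; have /andP[_] := truth a (fsubsetP sD _ aD).
by rewrite aD => /negP.
Qed.

Theorem corollary4p9 (G D : {fset formula}) :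
  provable G D -> exists p : proof G D, cut_free p.
Proof.
by case=> p; apply: completeness => v; apply: soundness p.
Qed.
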